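(* Let $G$ be a finite bicoloured graph with a split $V(G)=V_1\cup V_2$. Then for every $H\in[G]$, $V_1\cup V_2$ is a split of $H$, and $\{(Rw_H,Lw_H),(Rb_H,Lb_H),(Rc_H,Lc_H)\}=\{(Rw_G,Lw_G),(Rb_G,Lb_G),(Rc_G,Lc_G)\}$ and $\{(Rw'_H,Lw'_H),(Rb'_H,Lb'_H),(Rc'_H,Lc'_H)\}=\{(Rw'_G,Lw'_G),(Rb'_G,Lb'_G),(Rc'_G,Lc'_G)\}$ as sets of ordered pairs of parity classes (i.e. the three pairs are the same up to permutation).
   Context: Bicoloured graphs are simple graphs with vertices coloured black/white. For bicoloured $G$ and $u\in V(G)$, $Gu$ has edge set $E(G)\triangle\{[x,y]:x\ne y\in N_G(u)\}$ and the same colouring if $u$ is black, while if $u$ is white the colours of all vertices of $N_G(u)$ are reversed; $Gu_1\cdots u_k=(\cdots(Gu_1)\cdots)u_k$. $W^\circ(G)$ is the smallest set of words containing the empty word such that $s\in W^\circ(G)$, $u$ white in $Gs$ implies $su\in W^\circ(G)$, and $s\in W^\circ(G)$, $u,v$ adjacent black in $Gs$ implies $suvu,svuv\in W^\circ(G)$; the parity class is $[G]=\{Gs:s\in W^\circ(G)\}$. A split of $G$ is a partition $V(G)=V_1\cup V_2$ with $|V_1|,|V_2|\ge2$ such that every vertex of $V_2$ with a neighbour in $V_1$ is adjacent to every vertex of $V_1$ with a neighbour in $V_2$. A rooted graph $(K,z)$ is a simple graph with a vertex $z$ and a black/white colouring of $V(K)\setminus\{z\}$. The split induces $(K_1,z_1)$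 from a bicoloured graph $K$ with this split: replace $V_2$ by a new vertex $z_1$ adjacent exactly to the vertices of $V_1$ having a neighbour in $V_2$ (colours on $V_1$ kept); symmetrically $(K_2,z_2)$. For a rooted graph $(R,z)$: $rw(R)$: colour $z$ white; $rb(R)$: colour $z$ black; $rc(R)$: colour $z$ white, complement at $z$, recolour $z$ black; $lw(R)=R-z$; $lb(R)$: colour $z$ white, complement at $z$, delete $z$; for a neighbour $v$ of $z$, $lc_v(R)$: colour $z$ black, form $R\{z,v\}$ and delete $z$, where for a black $u$ adjacent to $v$, $R\{u,v\}=Rvu$ if $v$ is white and $Rvuv$ if $v$ is black. For $K\in\{G,H\}$ with induced rooted graphs $(K_1,z_1),(K_2,z_2)$: $Rw_K=[rw(K_1)]$, $Lw_K=[lw(K_2)]$, $Rb_K=[rb(K_1)]$, $Lb_K=[lb(K_2)]$; if $K$ has an edge between $V_1$ and $V_2$, $Rc_K=[rc(K_1)]$ and $Lc_K=[lc_v(K_2)]$ for a neighbour $v$ of $z_2$ in $K_2$ (this class does not depend on $v$), otherwise $Rc_K=Lc_K=[\emptyset]$, the class of the empty graph. The primed quantities $Rw'_K,\dots,Lc'_K$ are defined in the same way with the roles of $V_1$ and $V_2$ interchanged. *)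

(* Defs.v *)
From Stdlib Require Export Permutation.
From mathcomp Require Export classical_sets.
From mathcomp Require Export all_boot.

Set Implicit Arguments.
Unset Strict Implicit.
Unset Printing Implicit Defensive.

(* A finite simple graph whose vertices are some of the elements of T.  The
   vertex set is a field, rather than the whole type, so that graphs on
   different vertex sets (induced graphs, the empty graph) have the same type
   and their parity classes can be compared. *)
Record sgraph (T : finType) := SGraph {
  vset : {set T};
  adj : rel T;
  adj_sym : symmetric adj;
  adj_irr : irreflexive adj;
  adj_vset : forall x y, adj x y -> x \in vset }.

Record bigraph (T : finType) := BiGraph {
  bgraph :> sgraph T;
  black : {set T};
  black_sub : black \subset vset bgraph }.

(* The root carries no colour: rblack is the set of black non-root vertices. *)
Record rgraph (T : finType) := RGraph {
  rootg :> sgraph T;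
  root : T;
  rblack : {set T};
  root_vset : root \in vset rootg;
  rblack_sub : rblack \subset vset rootg :\ root }.

Section Operations.
Variable T : finType.
Implicit Types (G : bigraph T) (R : rgraph T) (u v z : T).

Definition nbr (S : sgraph T) u : {set T} := [set x | adj S u x].
Definition is_white G u := u \in vset G :\: black G.
Definition is_black G u := u \in black G.

Definition slc_adj (S : sgraph T) u : rel T := fun x y =>
  adj S x y (+) [&& x != y, x \in nbr S u & y \in nbr S u].

Lemma slc_sym (S : sgraph T) u : symmetric (slc_adj S u).
Proof.
by move=> x y; rewrite /slc_adj (adj_sym S) eq_sym [(x \in _) && _]andbC.
Qed.

Lemma slc_irr (S : sgraph T) u : irreflexive (slc_adj S u).
Proof. by move=> x; rewrite /slc_adj (adj_irr S) eqxx. Qed.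

Lemma slc_vset (S : sgraph T) u x y : slc_adj S u x y -> x \in vset S.
Proof.
rewrite /slc_adj; case: (boolP (adj S x y)) => [/adj_vset //|_] /= /and3P[_].
by rewrite inE (adj_sym S) => /adj_vset.
Qed.

Definition slc (S : sgraph T) u : sgraph T :=
  SGraph (@slc_sym S u) (@slc_irr S u) (@slc_vset S u).

(* The colours of the vertices of N are reversed. *)
Definition flip (B N : {set T}) : {set T} := (B :\: N) :|: (N :\: B).

Lemma flip_sub (A B N : {set T}) :
  B \subset A -> N \subset A -> flip B N \subset A.
Proof.
move=> sB sN; rewrite subUset.
by rewrite !(subset_trans (subsetDl _ _)).
Qed.

Lemma nbr_sub (S : sgraph T) u : nbr S u \subset vset S.
Proof.
by apply/subsetP => x; rewrite inE (adj_sym S) => /adj_vset.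
Qed.

Lemma lcomp_sub G u :
  (if is_black G u then black G else flip (black G) (nbr G u))
    \subset vset (slc G u).
Proof. by case: ifP => _; [|apply: flip_sub (nbr_sub _ _)]; exact: black_sub. Qed.

(* The graph Gu. *)
Definition lcomp G u : bigraph T := BiGraph (lcomp_sub G u).

Definition word_act G (s : seq T) : bigraph T := foldl lcomp G s.

Inductive Wo G : seq T -> Prop :=
| Wo_nil : Wo G [::]
| Wo_white s u : Wo G s -> is_white (word_act G s) u -> Wo G (s ++ [:: u])
| Wo_black_uvu s u v : Wo G s ->
    is_black (word_act G s) u -> is_black (word_act G s) v ->
    adj (word_act G s) u v -> Wo G (s ++ [:: u; v; u])
| Wo_black_vuv s u v : Wo G s ->
    is_black (word_act G s) u -> is_black (word_act G s) v ->
    adj (word_act G s) u v -> Wo G (s ++ [:: v; u; v]).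

Definition parity_class G : set (bigraph T) :=
  [set H | exists2 s, Wo G s & H = word_act G s]%classic.

Definition is_split G (V1 V2 : {set T}) : Prop :=
  [/\ V1 :|: V2 = vset G, [disjoint V1 & V2],
      2 <= #|V1|, 2 <= #|V2| &
      forall x y, x \in V1 -> y \in V2 ->
        (exists2 y', y' \in V2 & adj G x y') ->
        (exists2 x', x' \in V1 & adj G x' y) -> adj G x y].

Lemma empty_irr : irreflexive (fun _ _ : T => false).
Proof. by []. Qed.

Lemma empty_vset (x y : T) : false -> x \in (set0 : {set T}).
Proof. by []. Qed.

Definition sempty : sgraph T :=
  @SGraph T set0 (fun _ _ => false) (fun _ _ => erefl) empty_irr empty_vset.

Definition empty_graph : bigraph T := @BiGraph T sempty set0 (sub0set _).

Definition del_adj (S : sgraph T) z : rel T := fun x y =>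
  [&& x != z, y != z & adj S x y].

Lemma del_sym (S : sgraph T) z : symmetric (del_adj S z).
Proof. by move=> x y; rewrite /del_adj (adj_sym S) andbCA. Qed.

Lemma del_irr (S : sgraph T) z : irreflexive (del_adj S z).
Proof. by move=> x; rewrite /del_adj (adj_irr S) !andbF. Qed.

Lemma del_vset (S : sgraph T) z x y : del_adj S z x y -> x \in vset S :\ z.
Proof. by case/and3P=> xz _ /adj_vset xS; rewrite !inE xz. Qed.

Definition sdel (S : sgraph T) z : sgraph T :=
  SGraph (@del_sym S z) (@del_irr S z) (@del_vset S z).

Lemma delete_sub G z : black G :\ z \subset vset (sdel G z).
Proof. by rewrite setSD // black_sub. Qed.

Definition delete G z : bigraph T := BiGraph (delete_sub G z).

Lemma blacken_sub G z : vset G :&: (z |: black G) \subset vset G.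
Proof. exact: subsetIl. Qed.

(* Recolours the vertex z black (no effect if z is not a vertex of G). *)
Definition blacken G z : bigraph T := BiGraph (blacken_sub G z).

Lemma root_white_sub R : rblack R \subset vset R.
Proof. exact: subset_trans (rblack_sub R) (subD1set _ _). Qed.

Definition root_white R : bigraph T := BiGraph (root_white_sub R).
Definition root_black R : bigraph T := blacken (root_white R) (root R).

(* G{u,v}, for a black vertex u adjacent to v. *)
Definition pivot G u v : bigraph T :=
  if is_black G v then word_act G [:: v; u; v] else word_act G [:: v; u].

Definition rw R : bigraph T := root_white R.
Definition rb R : bigraph T := root_black R.
Definition rc R : bigraph T := blacken (lcomp (root_white R) (root R)) (root R).

(* R - z: the colour given to the root here is irrelevant, as it is deleted. *)
Definition lw R : bigraph T := delete (root_white R) (root R).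

Definition lb R : bigraph T := delete (lcomp (root_white R) (root R)) (root R).
Definition lc R v : bigraph T :=
  delete (pivot (root_black R) (root R) v) (root R).

End Operations.

Section Induced.
Variable T : finType.
Implicit Type K : bigraph T.

Definition ind_adj K (V1 V2 : {set T}) : rel (option T) := fun a b =>
  match a, b with
  | Some x, Some y => [&& x \in V1, y \in V1 & adj K x y]
  | Some x, None | None, Some x => (x \in V1) && [exists y in V2, adj K x y]
  | None, None => false
  end.

Definition ind_verts (V1 : {set T}) : {set option T} := None |: (Some @: V1).

Lemma ind_sym K (V1 V2 : {set T}) : symmetric (ind_adj K V1 V2).
Proof. by move=> [x|] [y|] //=; rewrite (adj_sym K) andbCA. Qed.

Lemma ind_irr K (V1 V2 : {set T}) : irreflexive (ind_adj K V1 V2).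
Proof. by move=> [x|] //=; rewrite (adj_irr K) !andbF. Qed.

Lemma ind_vset K (V1 V2 : {set T}) a b : ind_adj K V1 V2 a b -> a \in ind_verts V1.
Proof.
case: a => [x|] ab; last by rewrite !inE.
suff xV : x \in V1 by rewrite !inE; apply: imset_f.
by case: b ab => [y /and3P[]|/andP[]].
Qed.

Lemma ind_root (V1 : {set T}) : None \in ind_verts V1.
Proof. by rewrite !inE. Qed.

Lemma ind_black K (V1 : {set T}) :
  Some @: (black K :&: V1) \subset ind_verts V1 :\ None.
Proof.
apply/subsetP => a /imsetP[x]; rewrite inE => /andP[_ xV] ->.
by rewrite !inE /=; apply: imset_f.
Qed.

(* The rooted graph (K_1, z_1) obtained by replacing V2 by a new vertex: the
   vertices of V1 are embedded by Some and the new vertex is None.  The rooted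
   graph (K_2, z_2) is induced K V2 V1. *)
Definition induced K (V1 V2 : {set T}) : rgraph (option T) :=
  @RGraph (option T)
    (SGraph (@ind_sym K V1 V2) (@ind_irr K V1 V2) (@ind_vset K V1 V2))
    None (Some @: (black K :&: V1)) (ind_root V1) (ind_black K V1).

Definition crosses K (V1 V2 : {set T}) : bool :=
  [exists x in V1, exists y in V2, adj K x y].

Definition empty_class : set (bigraph (option T)) :=
  parity_class (empty_graph (option T)).

Definition Rw K (V1 V2 : {set T}) := parity_class (rw (induced K V1 V2)).
Definition Lw K (V1 V2 : {set T}) := parity_class (lw (induced K V2 V1)).
Definition Rb K (V1 V2 : {set T}) := parity_class (rb (induced K V1 V2)).
Definition Lb K (V1 V2 : {set T}) := parity_class (lb (induced K V2 V1)).
Definition Rc K (V1 V2 : {set T}) :=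
  if crosses K V1 V2 then parity_class (rc (induced K V1 V2)) else empty_class.

(* An arbitrary neighbour v of the root is picked, the class being independent
   of v; there is one exactly when K has an edge between V1 and V2. *)
Definition Lc K (V1 V2 : {set T}) :=
  let K2 := induced K V2 V1 in
  if [pick v in nbr K2 (root K2)] is Some v then parity_class (lc K2 v)
  else empty_class.

(* Two such lists being permutations of each other gives the equality of the
   corresponding sets of pairs, and is meaningful also when pairs coincide. *)
Definition class_pairs K (V1 V2 : {set T}) :
    seq (set (bigraph (option T)) * set (bigraph (option T))) :=
  [:: (Rw K V1 V2, Lw K V1 V2); (Rb K V1 V2, Lb K V1 V2);
      (Rc K V1 V2, Lc K V1 V2)].

End Induced.

(* Main.v *)
Require Import Defs.
From mathcomp Require Import boolp.

(** With 1 on the diagonal at white vertices, a bicoloured graph is a symmetric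
    matrix M over GF(2), encoded by the Lagrangian space {(p, q) | q = M p}.
    The generators
    of W^o are the principal pivots on one white vertex or one black edge, i.e.
    exchanges of p and q on a set of vertices, and every such exchange between
    two graphs decomposes into these pivots.  So [G] is the class of G up to
    exchanges.  The six operations on a rooted graph amount, up to exchanges, to
    applying an element of GL(2, 2) to the pair (p, q) at the root and possibly
    deleting the root.  A generator applied to G acts on K1 and K2 by exchanges
    away from the roots and by two conjugate elements of GL(2, 2) at the roots,
    which permutes the three pairs. *)

Set Implicit Arguments.
Unset Strict Implicit.
Unset Printing Implicit Defensive.

(** * Lagrangian spaces over GF(2) and principal pivots *)

Section Lagrangian.
Variable V : finType.
Implicit Types (M N : rel V) (u v x y z : V) (X : {set V}).
Implicit Types (w : V -> bool * bool) (s : V -> bool * bool -> bool * bool).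
Implicit Types (f g h : bool * bool -> bool * bool).

Definition lag M w :=
  forall x, (w x).2 = \big[addb/false]_y (M x y && (w y).1).

Definition lag_map s M N := forall w, lag M w <-> lag N (fun x => s x (w x)).

(* With the identity, the three transpositions of GL(2, 2). *)
Definition swap (t : bool * bool) := (t.2, t.1).
Definition shear2 (t : bool * bool) := (t.1, t.1 (+) t.2).
Definition shear1 (t : bool * bool) := (t.1 (+) t.2, t.2).

Lemma swapK : involutive swap. Proof. by case. Qed.
Lemma shear2K : involutive shear2. Proof. by case=> [[] []]. Qed.
Lemma shear1K : involutive shear1. Proof. by case=> [[] []]. Qed.

Definition swap_on X x : bool * bool -> bool * bool :=
  if x \in X then swap else id.

Lemma swap_onK X x : involutive (swap_on X x).
Proof. by rewrite /swap_on; case: ifP => _ //; exact: swapK. Qed.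

Lemma lag_map_comp s s' M N P :
  lag_map s M N -> lag_map s' N P -> lag_map (fun x => s' x \o s x) M P.
Proof. by move=> h k w; rewrite (h w) (k _). Qed.

Lemma eq_lag_map s s' M N : s =2 s' -> lag_map s M N -> lag_map s' M N.
Proof.
move=> e h w; rewrite (h w).
by under eq_fun do rewrite e.
Qed.

Lemma involutive_lag_map s M N : (forall x, involutive (s x)) ->
  (forall w, lag M w -> lag N (fun x => s x (w x))) ->
  (forall w, lag N w -> lag M (fun x => s x (w x))) -> lag_map s M N.
Proof.
move=> sK h k w; split; first exact: h.
by move=> /k; under eq_fun do rewrite sK.
Qed.

Lemma lag_map_sym s M N :
  (forall x, involutive (s x)) -> lag_map s M N -> lag_map s N M.
Proof.
move=> sK h w; rewrite (h _).
by under [X in _ <-> lag N X]eq_fun do rewrite sK.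
Qed.

(** When [M u u] holds, this is the principal pivot transform at u: the Schur complement away from
    u, with row and column u kept. *)
Definition pivot1 M u : rel V := fun x y =>
  M x y (+) [&& x != u, y != u, M x u & M u y].

Definition exch u v x := if x == u then v else if x == v then u else x.

(** The principal pivot transform on a block with zero diagonal and ones elsewhere. Such a block is
    its own inverse, hence the exchange of rows and columns u and v; outside it stands the Schur
    complement. *)
Definition pivot2 M u v : rel V := fun x y =>
  M (exch u v x) (exch u v y) (+)
  [&& x != u, x != v, y != u, y != v & (M x u && M v y) (+) (M x v && M u y)].

Definition toggle M z : rel V := fun x y => M x y (+) ((x == z) && (y == z)).

(** Row and column z are zeroed rather than removed, which keeps the index type. In the resulting
    space q vanishes at z and p is free there. *)
Definition del M z : rel V := fun x y => [&& x != z, y != z & M x y].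

Lemma pivot1K M u : M u u -> pivot1 (pivot1 M u) u = M.
Proof.
move=> Mu; apply/funext=> x; apply/funext=> y.
rewrite /pivot1 eqxx /= !andbF !addbF.
by case: (x == u); case: (y == u); case: (M x y); case: (M x u); case: (M u y).
Qed.

Lemma toggleK M z : toggle (toggle M z) z = M.
Proof.
by apply/funext=> x; apply/funext=> y; rewrite /toggle -addbA addbb addbF.
Qed.

Lemma pivot2K M u v : u != v -> M u v -> M v u -> ~~ M u u -> ~~ M v v ->
  pivot2 (pivot2 M u v) u v = M.
Proof.
move=> uv Muv Mvu /negbTE Mu /negbTE Mv.
apply/funext=> x; apply/funext=> y; rewrite /pivot2 /exch.
have vu : (v == u) = false by rewrite eq_sym (negbTE uv).
pose E := (eqxx, vu, negbTE uv).
have [->|xu] := eqVneq x u; have [->|yu] := eqVneq y u;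
  rewrite ?E ?(negbTE xu) ?(negbTE yu) /= ?E ?(negbTE xu) ?(negbTE yu) /=
    ?Mu ?Mv ?Muv ?Mvu ?andbF ?addbF //.
- have [->|yv] := eqVneq y v; rewrite ?E ?(negbTE yu) ?(negbTE yv) /=
    ?Mu ?Mv ?Muv ?Mvu ?andbF ?addbF //.
- have [->|xv] := eqVneq x v; rewrite ?E ?(negbTE xu) ?(negbTE xv) /=
    ?Mu ?Mv ?Muv ?Mvu ?andbF ?addbF //.
have [->|xv] := eqVneq x v; have [->|yv] := eqVneq y v;
  rewrite ?E ?(negbTE xu) ?(negbTE xv) ?(negbTE yu) ?(negbTE yv) /=
    ?Mu ?Mv ?Muv ?Mvu ?andbF ?addbF //=.
by case: (M x y); case: (M x u); case: (M x v); case: (M u y); case: (M v y).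
Qed.

(** Since [M u u] is 1, the equation at u can be solved for p at u; substituting the result into the
    other equations produces the Schur complement. *)
Lemma lag_pivot1 M u : M u u -> lag_map (swap_on [set u]) M (pivot1 M u).
Proof.
suff fwd N w : N u u -> lag N w ->
    lag (pivot1 N u) (fun x => swap_on [set u] x (w x)).
  move=> Mu; apply: involutive_lag_map => [||w].
  - exact: swap_onK.
  - by move=> w; apply: fwd.
  (* Pivoting is an involution, so the converse is the forward direction for the pivoted matrix. *)
  - by rewrite -{2}(pivot1K Mu); apply: fwd; rewrite /pivot1 eqxx addbF.
move=> Nu Lw x; rewrite (bigD1 u) //= /swap_on !inE eqxx /=.
(* The equation at y, solved for the part of the sum that avoids u. *)
have S y : \big[addb/false]_(i | i != u) (N y i && (w i).1) =
    (w y).2 (+) (N y u && (w u).1).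
  by rewrite (Lw y) [in RHS](bigD1 u) //= [RHS]addbC addKb.
have [->|xu] := eqVneq x u.
  under eq_bigr => i iu do rewrite /pivot1 eqxx /= addbF !inE (negbTE iu).
  by rewrite S /pivot1 eqxx Nu /=; case: (w u) => [[] []].
under eq_bigr => i iu do
  rewrite /pivot1 xu iu /= !inE (negbTE iu) andb_addl -andbA.
rewrite big_split -big_distrr /= !S Nu /pivot1 eqxx /= andbF addbF.
by case: (w x) => p [] /=; case: (N x u) => //; case: (w u) => [[] []].
Qed.

(** The block is antidiagonal, so the equation at u yields p at v and the equation at v yields p at
    u. *)
Lemma lag_pivot2 M u v : u != v -> M u v -> M v u -> ~~ M u u -> ~~ M v v ->
  lag_map (swap_on [set u; v]) M (pivot2 M u v).
Proof.
move=> uv; have vu : (v == u) = false by rewrite eq_sym (negbTE uv).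
suff fwd N w : N u v -> N v u -> ~~ N u u -> ~~ N v v -> lag N w ->
    lag (pivot2 N u v) (fun x => swap_on [set u; v] x (w x)).
  move=> h1 h2 h3 h4; apply: involutive_lag_map => [||w].
  - exact: swap_onK.
  - by move=> w; apply: fwd.
  - by rewrite -{2}(pivot2K uv h1 h2 h3 h4); apply: fwd;
      rewrite /pivot2 /exch ?eqxx ?vu ?eqxx /= ?andbF ?addbF.
move=> Nuv Nvu /negbTE Nu /negbTE Nv Lw x.
rewrite (bigD1 u) // (bigD1 v) /= ?vu // /swap_on !inE !eqxx orbT /=.
have S y : \big[addb/false]_(i | (i != u) && (i != v)) (N y i && (w i).1) =
    (w y).2 (+) (N y u && (w u).1) (+) (N y v && (w v).1).
  rewrite (Lw y) [in RHS](bigD1 u) // [in RHS](bigD1 v) /= ?vu //.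
  by rewrite addbC [X in _ (+) X]addbC addKb addKb.
have E i : (i != u) && (i != v) -> (i == u = false) * (i == v = false).
  by case/andP => /negbTE -> /negbTE ->.
have [->|xu] := eqVneq x u.
  under eq_bigr => i iu do
    rewrite /pivot2 /exch !inE eqxx /= !(E i iu) /= addbF.
  rewrite S /pivot2 /exch !eqxx vu /= !addbF Nv Nvu /=.
  by case: (w u) => [[] []]; case: (w v) => [[] []].
have [->|xv] := eqVneq x v.
  under eq_bigr => i iu do
    rewrite /pivot2 /exch !inE eqxx vu /= !(E i iu) /= addbF.
  rewrite S /pivot2 /exch !eqxx vu /= !addbF Nu Nuv /=.
  by case: (w u) => [[] []]; case: (w v) => [[] []].
under eq_bigr => i iu do
  rewrite /pivot2 /exch !inE (negbTE xu) (negbTE xv) /= !(E i iu) /=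
   !andb_addl -!andbA.
rewrite !big_split -!big_distrr /= !S Nu Nv Nuv Nvu /pivot2 /exch !eqxx vu /=.
rewrite (negbTE xu) (negbTE xv) /= !addbF.
case: (w x) => p [] /=; case: (N x u); case: (N x v) => //=;
 by case: (w u) => [[] []]; case: (w v) => [[] []].
Qed.

(** * Exchanges away from a root, with a prescribed action at the root *)

Definition root_act z f X x : bool * bool -> bool * bool :=
  if x == z then f else swap_on X x.

Definition rlag_map z f M N := exists X, lag_map (root_act z f X) M N.

Lemma rlag_map_refl z M : rlag_map z id M M.
Proof.
exists set0 => w.
suff -> : (fun x => root_act z id set0 x (w x)) = w by [].
by apply/funext=> x; rewrite /root_act /swap_on inE; case: ifP.
Qed.

Lemma swap_on_rlag_map z X M N : lag_map (swap_on X) M N ->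
  rlag_map z (swap_on X z) M N.
Proof.
move=> h; exists X; apply: eq_lag_map h => x t.
by rewrite /root_act; case: eqP => [->|].
Qed.

(** An action at the root that is the identity or [swap] is itself an exchange: z is removed from,
    or added to, the exchange set. *)
Lemma rlag_map_swap z f M N : rlag_map z f M N -> f =1 id \/ f =1 swap ->
  exists X, lag_map (swap_on X) M N.
Proof.
case=> X h [] e.
  exists (X :\ z); apply: eq_lag_map h => x t.
  by rewrite /root_act /swap_on !inE; case: eqP => //= _; exact: e.
exists (z |: X); apply: eq_lag_map h => x t.
by rewrite /root_act /swap_on !inE; case: eqP => //= _; exact: e.
Qed.

Lemma rlag_map_sym z f M N : involutive f ->
  rlag_map z f M N -> rlag_map z f N M.
Proof.
move=> fK [X h]; exists X; apply: lag_map_sym h => x.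
by rewrite /root_act; case: ifP => _ //; exact: swap_onK.
Qed.

Lemma rlag_map_trans z f g M N P :
  rlag_map z f M N -> rlag_map z g N P -> rlag_map z (g \o f) M P.
Proof.
(* Two swaps at one vertex cancel, so exchange sets compose by symmetric difference. *)
move=> [X h] [Y k]; exists ((X :\: Y) :|: (Y :\: X)).
apply: eq_lag_map (lag_map_comp h k) => x t /=.
rewrite /root_act /swap_on !inE; case: ifP => // _.
by case: (x \in X); case: (x \in Y) => //=; case: t.
Qed.

Lemma eq_rlag_map z f g M N : f =1 g -> rlag_map z f M N -> rlag_map z g M N.
Proof. by move=> /funext ->. Qed.

(** The new diagonal entry contributes p at z to the equation at z, and [shear2] adds the same term
    to q. *)
Lemma rlag_map_toggle z M : rlag_map z shear2 M (toggle M z).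
Proof.
exists set0; suff fwd N w : lag N w ->
    lag (toggle N z) (fun x => root_act z shear2 set0 x (w x)).
  apply: involutive_lag_map => [x||w].
  - by rewrite /root_act; case: ifP => _; [exact: shear2K|exact: swap_onK].
  - by move=> w; apply: fwd.
  - by rewrite -{2}(toggleK M z); apply: fwd.
move=> Lw x; rewrite /root_act /swap_on /toggle.
have E y : (if y == z then shear2 else if y \in set0 then swap else id) (w y) =
    ((w y).1, (w y).2 (+) ((y == z) && (w y).1)).
  by rewrite inE; case: eqP => _ /=; case: (w y) => [[] []].
rewrite E /=; under eq_bigr do rewrite E /= andb_addl.
rewrite big_split /= -Lw; congr (_ (+) _).
rewrite (bigD1 z) //= eqxx andbT big1 ?addbF => [|i /negbTE ->]; last first.
  by rewrite andbF.
by case: eqP => [->|].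
Qed.

(** Symplectic reduction at z: the other coordinates come from a vector of the original space with p
    zero at z. Deletion forgets its q at z, which is the existential [b]. *)
Lemma lag_del z M w : lag (del M z) w <-> ~~ (w z).2 /\
  exists b, lag M (fun x => if x == z then (false, b) else w x).
Proof.
have S x b : x != z -> \big[addb/false]_y (del M z x y && (w y).1) =
   \big[addb/false]_y (M x y && (if y == z then (false, b) else w y).1).
  move=> xz; apply: eq_bigr => i _; rewrite /del xz /=.
  by case: (i == z); rewrite //= andbF.
split=> [Lw|[wz [b Lw]] x].
  split; first by rewrite Lw big1 // => i _; rewrite /del eqxx.
  (* The value of q forced by the equation at z; the [true] is a placeholder, as only first
     components are read. *)
  pose b := \big[addb/false]_y
    (M z y && (if y == z then (false, true) else w y).1).
  exists b => x; have [->|xz] := eqVneq x z.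
    by apply: eq_bigr => i _; case: ifP.
  by rewrite Lw; exact: S.
have [->|xz] := eqVneq x z.
  by rewrite (negbTE wz) big1 // => i _; rewrite /del eqxx.
by rewrite (S _ b xz) -Lw (negbTE xz).
Qed.

(* Deleting z keeps the part of the Lagrangian where p vanishes at z, so f has
   to preserve p. *)
Lemma rlag_map_del z f M N : involutive f -> (forall t, (f t).1 = t.1) ->
  rlag_map z f M N -> rlag_map z id (del M z) (del N z).
Proof.
move=> fK f1 [X h]; exists X => w; rewrite !lag_del /root_act eqxx.
have fE b : f (false, b) = (false, (f (false, b)).2).
  by move: (f1 (false, b)); case: (f _) => a c /= ->.
have E b : (fun x => root_act z f X x (if x == z then (false, b) else w x)) =
   (fun x => if x == z then (false, (f (false, b)).2) else swap_on X x (w x)).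
  by apply/funext=> x; rewrite /root_act; case: eqP.
have D b : (fun x => if x == z then (false, b) else
     (if x == z then id else swap_on X x) (w x)) =
   (fun x => if x == z then (false, b) else swap_on X x (w x)).
  by apply/funext=> x; case: (x == z).
split=> [[wz [b Lb]]|[wz [b Lb]]]; split=> //; exists (f (false, b)).2.
  by rewrite D -E; apply/h.
rewrite D in Lb; apply/h; rewrite E.
by rewrite -!fE fK.
Qed.

End Lagrangian.

(** * Parity classes as classes of matrices up to exchanges *)

Section Matrices.
Variable V : finType.
Implicit Types (A B : bigraph V) (R : rgraph V) (u v x y z : V).

Definition mat A : rel V :=
  fun x y => if x == y then is_white A x else adj A x y.

Lemma is_whiteE A x : is_white A x = (x \in vset A) && (x \notin black A).
Proof. by rewrite /is_white inE andbC. Qed.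

Lemma mat_adj A x y : x != y -> mat A x y = adj A x y.
Proof. by rewrite /mat => /negbTE ->. Qed.

Lemma adj_neq (S : sgraph V) x y : adj S x y -> x != y.
Proof. by apply: contraTneq => ->; rewrite (adj_irr S). Qed.

Lemma mat_sym A x y : mat A x y = mat A y x.
Proof. by rewrite /mat eq_sym; case: eqP => [->//|_]; exact: (adj_sym A). Qed.

(** The matrix has a zero diagonal entry both at a black vertex and outside the vertex set, so the
    vertex sets have to be compared separately. *)
Lemma bigraph_eq A B : vset A = vset B -> mat A = mat B -> A = B.
Proof.
move=> eV eM; have eA : adj A = adj B.
  apply/funext=> x; apply/funext=> y; have [->|xy] := eqVneq x y.
    by rewrite (adj_irr A) (adj_irr B).
  by rewrite -!mat_adj // eM.
have eB : black A = black B.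
  apply/setP => x; have := congr1 (fun M : rel V => M x x) eM.
  rewrite /mat eqxx !is_whiteE -eV.
  case xA : (x \in vset A) => /=; first by do 2 case: (x \in black _).
  move=> _; apply/idP/idP;
    [move/(subsetP (black_sub A))|move/(subsetP (black_sub B))];
    by rewrite -?eV xA.
case: A eV eM eA eB => [[vA aA sA iA wA] bA subA].
case: B => [[vB aB sB iB wB] bB subB] /= eV _ eA eB.
subst vB aB bB.
move: subA subB; rewrite (Prop_irrelevance sA sB) (Prop_irrelevance iA iB).
rewrite (Prop_irrelevance wA wB) => subA subB.
by rewrite (bool_irrelevance subA subB).
Qed.

Lemma black_lcomp A u x : x \in black (lcomp A u) =
  (x \in black A) (+) (is_white A u && adj A u x).
Proof.
rewrite /= /is_black is_whiteE; case: ifP => _ /=; first by rewrite andbF addbF.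
rewrite andbT /flip !inE.
have -> : (u \in vset A) && adj A u x = adj A u x.
  by case: (boolP (adj A u x)) => [/adj_vset ->|_]; rewrite ?andbF.
by case: (x \in black A); case: (adj A u x).
Qed.

(** The Schur term is 1 exactly at pairs of neighbours of u: off the diagonal it toggles their
    edges, on the diagonal their colours. *)
Lemma mat_lcomp_white A u : is_white A u -> mat (lcomp A u) = pivot1 (mat A) u.
Proof.
move=> uw; apply/funext=> x; apply/funext=> y; rewrite /mat.
have [<-|xy] := eqVneq x y.
  rewrite !is_whiteE /pivot1 /= eqxx !is_whiteE black_lcomp uw /=.
  have [->|xu] := eqVneq x u; first by rewrite (adj_irr A) addbF addbF.
  rewrite /= (adj_sym A x) andbb.
  case: (boolP (adj A u x)) => [|_]; last by rewrite !addbF.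
  rewrite (adj_sym A) => /adj_vset -> /=.
  by case: (x \in black A).
rewrite /= /slc_adj !inE /pivot1 /= (negbTE xy) /=.
have [->|xu] := eqVneq x u; first by rewrite (adj_irr A).
have [->|yu] := eqVneq y u; first by rewrite (adj_irr A) andbF.
by rewrite /= (adj_sym A x u).
Qed.


(** All three complementations take place at black vertices, so no colour changes and only
    adjacencies have to be computed. *)
Lemma mat_pivot2 A u v : is_black A u -> is_black A v -> adj A u v ->
  mat (word_act A [:: u; v; u]) = pivot2 (mat A) u v.
Proof.
rewrite /is_black => ub vb uv.
have nuv := adj_neq uv.
have vu : (v == u) = false by rewrite eq_sym (negbTE nuv).
have av : adj A v u by rewrite (adj_sym A).
have B B' t : t \in black B' -> black (lcomp B' t) = black B'.
  by move=> tb; rewrite /= /is_black tb.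
have e1 := B A u ub.
have e2 : black (lcomp (lcomp A u) v) = black A by rewrite B e1.
have e3 : black (word_act A [:: u; v; u]) = black A.
  by rewrite [word_act _ _]/(lcomp (lcomp (lcomp A u) v) u) B e2.
have wE x : is_white (word_act A [:: u; v; u]) x = is_white A x.
  by rewrite !is_whiteE e3.
have uw : is_white A u = false by rewrite is_whiteE ub andbF.
have vw : is_white A v = false by rewrite is_whiteE vb andbF.
apply/funext=> x; apply/funext=> y; rewrite {1}/mat wE.
have [<-|xy] := eqVneq x y.
  rewrite /pivot2 /exch.
  have [->|xu] := eqVneq x u; first by rewrite /mat eqxx uw vw.
  have [->|xv] := eqVneq x v; first by rewrite /mat eqxx uw vw.
  by rewrite /= andbC (mat_sym A u) (mat_sym A v) addbb addbF /mat eqxx.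
do 6! rewrite /= /slc_adj ?inE.
rewrite /= /pivot2 /exch /mat.
have irr t : adj A t t = false := adj_irr A t.
have xyF := negbTE xy; have yxF : (y == x) = false by rewrite eq_sym.
have uvF := negbTE nuv.
rewrite !(eq_sym v) !(eq_sym u) (adj_sym A x u) (adj_sym A x v).
(* Each of x and y is u, v or neither; what remains in every case is a Boolean identity. *)
have [eu|xu] := eqVneq x u; [subst x|have [ev|xv] := eqVneq x v; [subst x|]];
  (have [eu|yu] := eqVneq y u;
    [subst y|have [ev|yv] := eqVneq y v; [subst y|]]);
  rewrite ?xyF ?yxF ?irr ?uv ?av ?vu ?uvF ?eqxx /=
    ?eqxx ?vu ?uvF ?xyF ?yxF /= ?uw ?vw ?irr ?uv ?av ?addbF ?andbF ?addbT //=.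
- by rewrite eq_sym (negbTE yv); case: (adj A u y); case: (adj A v y).
- by rewrite eq_sym (negbTE yu); case: (adj A u y); case: (adj A v y).
- rewrite (negbTE xv) (adj_sym A x u) (adj_sym A x v).
  by case: (adj A u x); case: (adj A v x).
- rewrite (negbTE xu) (adj_sym A x u) (adj_sym A x v).
  by case: (adj A u x); case: (adj A v x).
- by case: (adj A x y); case: (adj A u x); case: (adj A v x);
    case: (adj A u y); case: (adj A v y).
Qed.

Definition pivot_equiv A B :=
  vset A = vset B /\ exists X, lag_map (swap_on X) (mat A) (mat B).

Lemma pivot_equiv_refl A : pivot_equiv A A.
Proof.
split=> //; exists set0 => w; rewrite /swap_on.
by under [X in _ <-> lag _ X]eq_fun do rewrite inE.
Qed.

Lemma pivot_equiv_sym A B : pivot_equiv A B -> pivot_equiv B A.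
Proof.
case=> e [X h]; split=> //; exists X; apply: lag_map_sym h => x.
exact: swap_onK.
Qed.

Lemma lag_map_swap_on_comp (M N P : rel V) (X Y : {set V}) :
  lag_map (swap_on X) M N -> lag_map (swap_on Y) N P ->
  lag_map (swap_on ((X :\: Y) :|: (Y :\: X))) M P.
Proof.
move=> h k; apply: eq_lag_map (lag_map_comp h k) => x t.
rewrite /swap_on /= !inE.
by case: (x \in X); case: (x \in Y) => //=; case: t.
Qed.

Lemma pivot_equiv_trans A B C :
  pivot_equiv A B -> pivot_equiv B C -> pivot_equiv A C.
Proof.
case=> e [X h] [e' [Y k]]; split; first by rewrite e.
by exists ((X :\: Y) :|: (Y :\: X)); apply: lag_map_swap_on_comp h k.
Qed.

Lemma white_pivot_equiv A u : is_white A u -> pivot_equiv A (lcomp A u).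
Proof.
move=> uw; split=> //; exists [set u]; rewrite mat_lcomp_white //.
by apply: lag_pivot1; rewrite /mat eqxx.
Qed.

Lemma black_lag_map A u v : is_black A u -> is_black A v -> adj A u v ->
  lag_map (swap_on [set u; v]) (mat A) (mat (word_act A [:: u; v; u])).
Proof.
move=> ub vb uv; rewrite mat_pivot2 //.
have nuv := adj_neq uv; apply: lag_pivot2 => //; rewrite /mat ?eqxx ?is_whiteE.
- by rewrite (negbTE nuv).
- by rewrite eq_sym (negbTE nuv) (adj_sym A).
- by rewrite -/(is_black A u) ub andbF.
- by rewrite -/(is_black A v) vb andbF.
Qed.

Lemma black_pivot_equiv A u v : is_black A u -> is_black A v -> adj A u v ->
  pivot_equiv A (word_act A [:: u; v; u]).
Proof.
by move=> ub vb uv; split=> //; exists [set u; v]; exact: black_lag_map.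
Qed.

Lemma Wo_pivot_equiv A s : Wo A s -> pivot_equiv A (word_act A s).
Proof.
elim=> {s} [|s u _ IH w|s u v _ IH ub vb uv|s u v _ IH ub vb uv].
- exact: pivot_equiv_refl.
- rewrite /word_act foldl_cat; apply: pivot_equiv_trans IH _.
  exact: white_pivot_equiv.
- rewrite /word_act foldl_cat; apply: pivot_equiv_trans IH _.
  exact: black_pivot_equiv.
- rewrite /word_act foldl_cat; apply: pivot_equiv_trans IH _.
  by apply: black_pivot_equiv => //; rewrite (adj_sym (word_act A s)).
Qed.

(* The vector which is 1 at one element of X witnesses that the principal
   submatrix of B on X is nonzero. *)
Lemma swap_on_nonzero A B (X : {set V}) x :
  lag_map (swap_on X) (mat A) (mat B) -> x \in X ->
  exists2 y, y \in X & mat B x y.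
Proof.
move=> h xX; apply: contrapT => nB.
have nB' y : y \in X -> mat B x y = false.
  by move=> yX; apply/negP => Bxy; apply: nB; exists y.
pose w y := (y == x, mat B y x).
have Lw : lag (mat B) w.
  move=> y; rewrite (bigD1 x) //= eqxx andbT big1 ?addbF // => i /negbTE ->.
  by rewrite andbF.
have /(_ x) := proj1 (lag_map_sym (@swap_onK _ X) h w) Lw.
rewrite /swap_on xX /= eqxx big1 // => i _.
case: ifP => [iX|iX] /=; first by rewrite (mat_sym B) nB' // andbF.
by case: eqP => [ix|]; [rewrite ix xX in iX|rewrite andbF].
Qed.

(** Induction on the size of the exchange set X. The principal submatrix of B on X is nonzero, so X
    contains a white vertex or a black edge of B. Pivoting B there gives a graph C with a smaller
    exchange set from A; a word leads from A to C, and the same pivot leads from C back to B. *)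
Lemma pivot_equiv_Wo A B : pivot_equiv A B -> parity_class A B.
Proof.
case=> eV [X]; have [n] := ubnP #|X|.
elim: n => // n IH in B X eV *; rewrite ltnS => cX h.
have [X0|[x xX]] := set_0Vmem X.
  exists [::]; first exact: Wo_nil.
  apply/esym/bigraph_eq => //; apply/funext=> x; apply/funext=> y.
  (* The unit vector at y paired with column y of A; the equations of B for this vector read off
     column y of B. *)
  pose w i := (i == y, mat A i y).
  have Lw : lag (mat A) w.
    move=> i; rewrite (bigD1 y) //= eqxx andbT big1 ?addbF // => j /negbTE ->.
    by rewrite andbF.
  have /(_ x) := proj1 (h w) Lw; rewrite /swap_on X0 inE /= => ->.
  rewrite (bigD1 y) //= inE /= eqxx andbT big1 ?addbF // => j /negbTE jy.
  by rewrite inE /= jy andbF.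
(* C is B pivoted on a nonempty part Y of X; the last premise turns a word reaching C into
   membership of B in the class. *)
have step (C : bigraph V) (Y : {set V}) z :
    z \in Y -> Y \subset X -> vset C = vset B ->
    lag_map (swap_on Y) (mat B) (mat C) ->
    (forall s, Wo A s -> word_act A s = C -> parity_class A B) ->
    parity_class A B.
  move=> zY YX eC k; have [|||s Ws Cs] := IH C ((X :\: Y) :|: (Y :\: X)).
  - by rewrite eC.
  - have -> : Y :\: X = set0 by apply/eqP; rewrite setD_eq0.
    rewrite setU0; apply: leq_trans cX; rewrite cardsD (setIidPr YX) ltn_subrL.
    by rewrite !card_gt0; apply/andP; split; apply/set0Pn; [exists z|exists x].
  - exact: lag_map_swap_on_comp h k.
  - by move=> kk; apply: (kk s).
have white u : u \in X -> is_white B u -> parity_class A B.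
  move=> uX uw; have Bu : mat B u u by rewrite /mat eqxx.
  apply: (step (lcomp B u) [set u] u); rewrite ?inE ?sub1set //.
    by rewrite mat_lcomp_white //; exact: lag_pivot1.
  move=> s Ws Cs; have Cu : is_white (lcomp B u) u.
    have <- : mat (lcomp B u) u u = is_white (lcomp B u) u by rewrite /mat eqxx.
    by rewrite mat_lcomp_white // /pivot1 eqxx addbF.
  exists (s ++ [:: u]); first by apply: Wo_white; rewrite ?Cs.
  rewrite /word_act foldl_cat -/(word_act A s) Cs; apply: bigraph_eq => //=.
  by rewrite !mat_lcomp_white // pivot1K.
(* If neither x nor y is white, the nonzero entry lies off the diagonal and is a black edge. *)
have [y yX Bxy] := swap_on_nonzero h xX.
case: (boolP (is_white B x)) => [|xb]; first exact: white.
case: (boolP (is_white B y)) => [|yb]; first exact: white.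
have xy : x != y by apply: contraTneq Bxy => <-; rewrite /mat eqxx.
have Bx : ~~ mat B x x by rewrite /mat eqxx.
have By : ~~ mat B y y by rewrite /mat eqxx.
have Byx : mat B y x by rewrite mat_sym.
have axy : adj B x y by rewrite -mat_adj.
have blackE (C : bigraph V) t : t \in vset C -> ~~ mat C t t -> is_black C t.
  by rewrite /mat eqxx is_whiteE => ->; rewrite negbK.
have xV := adj_vset axy; have yV : y \in vset B.
  by move: axy; rewrite (adj_sym B) => /adj_vset.
have xB := blackE B x xV Bx; have yB := blackE B y yV By.
apply: (step (word_act B [:: x; y; x]) [set x; y] x) => //.
- by rewrite !inE eqxx.
- by rewrite subUset !sub1set xX yX.
- exact: black_lag_map.
move=> s Ws Cs; have eM := mat_pivot2 xB yB axy.
set C := word_act B _ in Cs eM.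
have yx : (y == x) = false by rewrite eq_sym (negbTE xy).
have Cx : is_black C x.
  by apply: blackE => //; rewrite eM /pivot2 /exch eqxx /= addbF.
have Cy : is_black C y.
  by apply: blackE => //; rewrite eM /pivot2 /exch yx !eqxx /= addbF.
have aC : adj C x y.
  by rewrite -mat_adj // eM /pivot2 /exch yx !eqxx /= addbF.
exists (s ++ [:: x; y; x]); first by apply: Wo_black_uvu; rewrite ?Cs.
rewrite /word_act foldl_cat -/(word_act A s) Cs -/(word_act C [:: x; y; x]).
by apply: bigraph_eq => //; rewrite mat_pivot2 // eM pivot2K.
Qed.

Lemma pivot_equiv_class A B :
  pivot_equiv A B -> parity_class A = parity_class B.
Proof.
have sub C D : pivot_equiv C D -> (parity_class D `<=` parity_class C)%classic.
  move=> CD E [s Ws ->]; apply: pivot_equiv_Wo.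
  exact: pivot_equiv_trans CD (Wo_pivot_equiv Ws).
move=> AB; apply/seteqP; split; apply: sub => //.
exact: pivot_equiv_sym.
Qed.

End Matrices.

(** * The six operations on a rooted graph as actions at the root *)

Section Rooted.
Variable V : finType.
Implicit Types (A B : bigraph V) (R : rgraph V) (z : V).
Implicit Types (f g : bool * bool -> bool * bool).

Lemma mat_blacken A z : is_white A z -> mat (blacken A z) = toggle (mat A) z.
Proof.
move=> zw; apply/funext=> x; apply/funext=> y; rewrite /mat /toggle.
have [<-|xy] := eqVneq x y; last first.
  case: eqP => [<-|_]; rewrite ?(negbTE xy) /= ?addbF //.
  by rewrite eq_sym (negbTE xy) addbF.
rewrite andbb !is_whiteE !inE; have [->|xz] := eqVneq x z.
  by move: zw; rewrite is_whiteE => /andP[-> ->].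
by rewrite addbF; case: (x \in vset A).
Qed.

Lemma mat_delete A z : mat (delete A z) = del (mat A) z.
Proof.
apply/funext=> x; apply/funext=> y; rewrite /mat /del /= /del_adj.
have [<-|xy] := eqVneq x y; last by [].
by rewrite !is_whiteE !inE; case: (x == z); rewrite //= andbF.
Qed.

(** The colour of the root does not survive its deletion. *)
Lemma del_toggle (M : rel V) z : del (toggle M z) z = del M z.
Proof.
apply/funext=> x; apply/funext=> y; rewrite /del /toggle.
by case: (x == z); case: (y == z); rewrite //= addbF.
Qed.

Lemma rw_white R : is_white (rw R) (root R).
Proof.
rewrite is_whiteE root_vset /=; apply/negP => /(subsetP (rblack_sub R)).
by rewrite !inE eqxx.
Qed.

Lemma mat_rb R : mat (rb R) = toggle (mat (rw R)) (root R).
Proof. exact/mat_blacken/rw_white. Qed.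

(** Complementing at the white root leaves it white, so the final recolouring is a toggle. *)
Lemma mat_rc R : mat (rc R) = toggle (pivot1 (mat (rw R)) (root R)) (root R).
Proof.
have zw := rw_white R; have e := mat_lcomp_white zw.
rewrite -e; apply: mat_blacken.
have <- : mat (lcomp (rw R) (root R)) (root R) (root R) =
  is_white (lcomp (rw R) (root R)) (root R) by rewrite /mat eqxx.
by rewrite e /pivot1 /mat !eqxx addbF.
Qed.

(* f is the effect on the pair (p, q) at the root, starting from R with a black
   root. *)
Definition rlink R f A :=
  [/\ vset A = vset R, involutive f & rlag_map (root R) f (mat (rb R)) (mat A)].

(** [N] is the matrix just before the root is deleted, where the action at the root can still be
    expressed. *)
Definition llink R f A :=
  [/\ vset A = vset R :\ root R, involutive f &
    exists2 N, rlag_map (root R) f (mat (rb R)) N & mat A = del N (root R)].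

Lemma rb_link R : rlink R id (rb R).
Proof.
split=> //; exact: rlag_map_refl.
Qed.

Lemma rw_link R : rlink R shear2 (rw R).
Proof.
split=> //; first exact: shear2K.
by rewrite mat_rb; apply: rlag_map_sym; [exact: shear2K|exact: rlag_map_toggle].
Qed.

(** From a black root: whiten, pivot, blacken. The composite of [shear2], [swap] and [shear2] is
    [shear1]. *)
Lemma rc_link R : rlink R shear1 (rc R).
Proof.
split=> //; first exact: shear1K.
have zz : mat (rw R) (root R) (root R) by rewrite /mat eqxx rw_white.
have h1 := rlag_map_toggle (root R) (pivot1 (mat (rw R)) (root R)).
have [_ _ h2] := rw_link R.
have h3 := swap_on_rlag_map (root R) (lag_pivot1 zz).
rewrite mat_rc; apply: eq_rlag_map (rlag_map_trans (rlag_map_trans h2 h3) h1).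
by rewrite /swap_on inE eqxx => [[[] []]].
Qed.

Lemma lw_link R : llink R id (lw R).
Proof.
split=> //; exists (mat (rb R)); first exact: rlag_map_refl.
by rewrite mat_delete mat_rb del_toggle.
Qed.

Lemma lb_link R : llink R shear1 (lb R).
Proof.
split=> //; first exact: shear1K.
exists (mat (rc R)); first by have [] := rc_link R.
by rewrite mat_delete mat_rc del_toggle mat_lcomp_white // rw_white.
Qed.

Lemma vset_pivot A u v : vset (pivot A u v) = vset A.
Proof. by rewrite /pivot; case: ifP. Qed.

(** For black v the pivot is on the edge from v to the root. For white v, complementing at v turns
    the root white and a pivot at the root follows. Either way the root undergoes one [swap],
    whichever v is used. *)
Lemma lc_link R v : adj R (root R) v -> llink R swap (lc R v).
Proof.
move=> zv; split; [by rewrite /= vset_pivot|exact: swapK|].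
exists (mat (pivot (rb R) (root R) v)); last exact: mat_delete.
have zV := root_vset R.
have vz : adj (rb R) v (root R) by rewrite (adj_sym (rb R)).
have zb : is_black (rb R) (root R) by rewrite /is_black !inE eqxx zV.
rewrite /pivot; case: ifP => vb.
  have := swap_on_rlag_map (root R) (black_lag_map vb zb vz).
  by rewrite /swap_on !inE eqxx orbT.
have vw : is_white (rb R) v.
  by rewrite is_whiteE (adj_vset vz) -/(is_black _ _) vb.
have Mv : mat (rb R) v v by rewrite /mat eqxx.
have h1 := lag_pivot1 Mv; rewrite -mat_lcomp_white // in h1.
have zw : is_white (lcomp (rb R) v) (root R).
  rewrite is_whiteE black_lcomp vw vz -/(is_black _ _) zb /= andbT.
  exact: zV.
have Mz : mat (lcomp (rb R) v) (root R) (root R) by rewrite /mat eqxx.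
have h2 := lag_pivot1 Mz; rewrite -mat_lcomp_white // in h2.
have := rlag_map_trans (swap_on_rlag_map (root R) h1)
  (swap_on_rlag_map (root R) h2).
by rewrite /swap_on !inE eqxx (negbTE (adj_neq zv)).
Qed.

Definition root_link f R R' :=
  [/\ vset R = vset R', root R = root R' &
      rlag_map (root R) f (mat (rb R)) (mat (rb R'))].

(** The composite at the root leads from A through R and R' to B, [g] being its own inverse. If it
    lies in the group generated by [swap], it is absorbed into the exchange set, so these classes
    correspond to cosets of that group in GL(2, 2). *)
Lemma rlink_class R R' f g g' A B : root_link f R R' -> rlink R g A ->
  rlink R' g' B -> g' \o f \o g =1 id \/ g' \o f \o g =1 swap ->
  parity_class A = parity_class B.
Proof.
move=> [eV ez hf] [eA gK hA] [eB _ hB] c.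
rewrite -ez in hB; apply: pivot_equiv_class; split; first by rewrite eA eB.
apply: rlag_map_swap c.
exact: rlag_map_trans (rlag_map_trans (rlag_map_sym gK hA) hf) hB.
Qed.

(** After deletion only the subspace p = 0 at the root matters, so the composite need only preserve
    p: the relevant group is generated by [shear2]. *)
Lemma llink_class R R' f g g' A B : root_link f R R' -> llink R g A ->
  llink R' g' B -> involutive (g' \o f \o g) ->
  (forall t, ((g' \o f \o g) t).1 = t.1) -> parity_class A = parity_class B.
Proof.
move=> [eV ez hf] [eA gK [N hA eN]] [eB _ [N' hB eN']] hK h1.
rewrite -ez in hB eB eN'; apply: pivot_equiv_class.
split; first by rewrite eA eB eV.
rewrite eN eN'; apply: rlag_map_swap (or_introl (frefl id)).
apply: rlag_map_del hK h1 _.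
exact: rlag_map_trans (rlag_map_trans (rlag_map_sym gK hA) hf) hB.
Qed.

End Rooted.

(** * How a change at the two roots permutes the three pairs *)

Section Pairs.
Variable T : finType.
Implicit Types (G H K : bigraph T).

(* The coordinates of the two root planes are glued by the swap, so f' is the
   conjugate of f by it. *)
Inductive glued :
  (bool * bool -> bool * bool) -> (bool * bool -> bool * bool) -> Prop :=
| Glued_id : glued id id
| Glued_12 : glued shear1 shear2
| Glued_21 : glued shear2 shear1
| Glued_swap : glued swap swap.

Lemma glued_sym f g : glued f g -> glued g f.
Proof. by case; constructor. Qed.

Lemma crossesP K (V1 V2 : {set T}) :
  reflect (exists x y, [/\ x \in V1, y \in V2 & adj K x y]) (crosses K V1 V2).
Proof.
apply: (iffP existsP).
  move=> [x /andP[xV /existsP[y /andP[yV xy]]]].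
  by exists x, y.
move=> [x [y [xV yV xy]]].
by exists x; rewrite xV; apply/existsP; exists y; rewrite yV.
Qed.

Lemma crosses_sym K (V1 V2 : {set T}) : crosses K V1 V2 = crosses K V2 V1.
Proof.
by apply/crossesP/crossesP => [] [x [y [xV yV xy]]];
  exists y, x; split=> //; rewrite (adj_sym K).
Qed.

(** A crossing edge gives the root a neighbour, so the choice in [Lc] succeeds. The chosen vertex is
    hidden, as its link is always [swap]. *)
Lemma Lc_cross K (V1 V2 : {set T}) : crosses K V1 V2 ->
  exists2 A, llink (induced K V2 V1) swap A & Lc K V1 V2 = parity_class A.
Proof.
move=> /crossesP[x [y [xV yV xy]]]; rewrite /Lc.
case: pickP => [v|/(_ (Some y))].
  by rewrite inE => zv; exists (lc (induced K V2 V1) v) => //; exact: lc_link.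
move/negbT/negP=> []; rewrite inE /= yV; apply/existsP; exists x.
by rewrite xV (adj_sym K).
Qed.

Lemma Lc_uncross K (V1 V2 : {set T}) :
  ~~ crosses K V1 V2 -> Lc K V1 V2 = @empty_class T.
Proof.
move=> nc; rewrite /Lc; case: pickP => // -[y|]; rewrite inE //=.
case/andP=> yV /existsP[x /andP[xV yx]]; case/crossesP: nc.
by exists x, y; rewrite (adj_sym K).
Qed.

(** The group GL(2, 2) acts on the three cosets of [swap] on one side and of [shear2] on the other.
    Glued elements induce the same permutation of the indices w, b, c on both sides. *)
Lemma class_pairs_perm f f' G H (V1 V2 : {set T}) :
  glued f f' -> crosses H V1 V2 = crosses G V1 V2 ->
  (~~ crosses G V1 V2 -> f = id /\ f' = id) ->
  root_link f (induced G V1 V2) (induced H V1 V2) ->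
  root_link f' (induced G V2 V1) (induced H V2 V1) ->
  Permutation (class_pairs H V1 V2) (class_pairs G V1 V2).
Proof.
move=> gl ec nc L1 L2; rewrite /class_pairs.
have r g g' A B : rlink (induced G V1 V2) g A -> rlink (induced H V1 V2) g' B ->
    g' \o f \o g =1 id \/ g' \o f \o g =1 swap ->
    parity_class B = parity_class A.
  by move=> a b c; apply/esym; exact: rlink_class L1 a b c.
have l g g' A B : llink (induced G V2 V1) g A -> llink (induced H V2 V1) g' B ->
    g' \o f' \o g =1 id \/ g' \o f' \o g =1 shear2 ->
    parity_class B = parity_class A.
  move=> a b c; apply/esym; apply: llink_class L2 a b _ _ => t.
    by case: c => /[dup] e -> ; rewrite e // shear2K.
  by case: c => ->.
(* Without crossing edges the third pair is empty on both sides and the root actions are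
   identities. *)
case cG: (crosses G V1 V2) in ec nc *; last first.
  have [//|ef ef'] := nc; subst f f'.
  rewrite /Rc ec cG !Lc_uncross ?cG ?ec //.
  rewrite /Rw /Rb /Lw /Lb.
  rewrite (r _ _ _ _ (rw_link _) (rw_link _))
    1?(r _ _ _ _ (rb_link _) (rb_link _))
    1?(l _ _ _ _ (lw_link _) (lw_link _))
    1?(l _ _ _ _ (lb_link _) (lb_link _)) //;
    by left=> -[[] []].
rewrite /Rc ec cG /Rw /Rb /Lw /Lb.
have [A lA ->] := Lc_cross cG; have [B lB ->] := Lc_cross ec.
(* The four cases give the identity and the transpositions of b and c, of w and b, and of w and c,
   in this order. *)
case: gl r l {nc L1 L2} => r l.
- rewrite (r _ _ _ _ (rw_link _) (rw_link _))
    1?(r _ _ _ _ (rb_link _) (rb_link _))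
    1?(r _ _ _ _ (rc_link _) (rc_link _)) 1?(l _ _ _ _ (lw_link _) (lw_link _))
    1?(l _ _ _ _ (lb_link _) (lb_link _)) 1?(l _ _ _ _ lA lB) //;
    try by [left=> -[[] []]|right=> -[[] []]].
- rewrite (r _ _ _ _ (rw_link _) (rw_link _))
    1?(r _ _ _ _ (rc_link _) (rb_link _))
    1?(r _ _ _ _ (rb_link _) (rc_link _)) 1?(l _ _ _ _ (lw_link _) (lw_link _))
    1?(l _ _ _ _ lA (lb_link _)) 1?(l _ _ _ _ (lb_link _) lB) //;
    try by [left=> -[[] []]|right=> -[[] []]].
  exact/perm_skip/perm_swap.
- rewrite (r _ _ _ _ (rb_link _) (rw_link _))
    1?(r _ _ _ _ (rw_link _) (rb_link _))
    1?(r _ _ _ _ (rc_link _) (rc_link _)) 1?(l _ _ _ _ (lb_link _) (lw_link _))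
    1?(l _ _ _ _ (lw_link _) (lb_link _)) 1?(l _ _ _ _ lA lB) //;
    try by [left=> -[[] []]|right=> -[[] []]].
  exact/perm_swap.
- rewrite (r _ _ _ _ (rc_link _) (rw_link _))
    1?(r _ _ _ _ (rb_link _) (rb_link _))
    1?(r _ _ _ _ (rw_link _) (rc_link _)) 1?(l _ _ _ _ lA (lw_link _))
    1?(l _ _ _ _ (lb_link _) (lb_link _)) 1?(l _ _ _ _ (lw_link _) lB) //;
    try by [left=> -[[] []]|right=> -[[] []]].
  exact: Permutation_rev [:: _; _; _].
Qed.

End Pairs.

(** * Splits as rank one blocks, and the effect of each generator *)

Section Split.
Variable T : finType.
Implicit Types (G H K : bigraph T) (M : rel T) (n m : pred T) (u v x y : T).

(* For n1, n2 supported in V1, V2 and both zero or both nonzero, a rank one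
   factorisation of the V1 x V2 block; n1, n2 are then the neighbourhoods of
   the roots of K1, K2. *)
Definition factors M (V1 V2 : {set T}) n1 n2 :=
  [/\ forall x y, x \in V1 -> y \in V2 -> M x y = n1 x && n2 y,
      forall x, n1 x -> x \in V1, forall y, n2 y -> y \in V2 &
      [exists x, n1 x] = [exists y, n2 y]].

(** The matrix of the rooted graph with a black root [None] whose neighbourhood is [n]. *)
Definition contract M (V : {set T}) n : rel (option T) := fun a b =>
  match a, b with
  | Some x, Some y => [&& x \in V, y \in V & M x y]
  | Some x, None | None, Some x => n x
  | None, None => false
  end.

Lemma factors_sym M (V1 V2 : {set T}) n1 n2 : symmetric M ->
  factors M V1 V2 n1 n2 -> factors M V2 V1 n2 n1.
Proof.
by move=> Ms [h s1 s2 e]; split=> // x y xV yV; rewrite Ms h // andbC.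
Qed.

Lemma is_split_sym G (V1 V2 : {set T}) : is_split G V1 V2 -> is_split G V2 V1.
Proof.
case=> eV d c1 c2 h; split; rewrite 1?setUC 1?disjoint_sym // => x y xV yV.
move=> [y' y'V xy'] [x' x'V x'y]; rewrite (adj_sym G); apply: h => //.
  by exists x' => //; rewrite (adj_sym G).
by exists y' => //; rewrite (adj_sym G).
Qed.

Section Fixed.
Variables V1 V2 : {set T}.
Hypothesis dV : [disjoint V1 & V2].

Lemma disjoint_neq x y :
  x \in V1 -> y \in V2 -> (x == y = false) * (y == x = false).
Proof.
move=> xV yV; suff xy : (x == y) = false by rewrite (eq_sym y) xy.
by apply: contraTF xV => /eqP ->; rewrite (disjointFl dV).
Qed.

Lemma split_factors G : is_split G V1 V2 ->
  exists n1 n2, factors (mat G) V1 V2 n1 n2.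
Proof.
case=> eV _ _ _ h.
exists (fun x => (x \in V1) && [exists y in V2, adj G x y]).
exists (fun y => (y \in V2) && [exists x in V1, adj G x y]).
split; [|by move=> x /andP[]|by move=> x /andP[]|].
  move=> x y xV yV; rewrite xV yV /mat (disjoint_neq xV yV) /=.
  apply/idP/andP => [xy|[/exists_inP p /exists_inP q]].
    by split; apply/exists_inP; [exists y|exists x].
  by apply: h.
apply/existsP/existsP => [] [x /andP[xV /exists_inP[y yV xy]]]; exists y;
  by rewrite yV /=; apply/exists_inP; exists x.
Qed.

Lemma factors_adj K n1 n2 x y : factors (mat K) V1 V2 n1 n2 ->
  x \in V1 -> y \in V2 -> adj K x y = n1 x && n2 y.
Proof. by move=> [h _ _ _] xV yV; rewrite -h // /mat (disjoint_neq xV yV). Qed.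

Lemma factors_split H n1 n2 : V1 :|: V2 = vset H -> 2 <= #|V1| -> 2 <= #|V2| ->
  factors (mat H) V1 V2 n1 n2 -> is_split H V1 V2.
Proof.
move=> eV c1 c2 F; split=> // x y xV yV [y' y'V xy'] [x' x'V x'y].
move: xy' x'y; rewrite !(factors_adj F) // => /andP[-> _] /andP[_ ->].
by [].
Qed.

(** Uses that the two factors vanish together: if [n1 x] holds, then [n2] holds somewhere and
    provides the neighbour. *)
Lemma factors_exists K n1 n2 x : factors (mat K) V1 V2 n1 n2 -> x \in V1 ->
  [exists y in V2, adj K x y] = n1 x.
Proof.
move=> F xV; apply/exists_inP/idP => [[y yV]|n1x].
  by rewrite (factors_adj F) // => /andP[].
have [_ _ s2 e] := F.
have /existsP[y n2y] : [exists y, n2 y] by rewrite -e; apply/existsP; exists x.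
by exists y; [exact: s2|rewrite (factors_adj F) ?n1x ?s2].
Qed.

Lemma crosses_factors K n1 n2 : factors (mat K) V1 V2 n1 n2 ->
  crosses K V1 V2 = [exists x, n1 x].
Proof.
move=> F; have [_ s1 _ _] := F; apply/existsP/existsP => [] [x].
  by case/andP=> xV; rewrite (factors_exists F) // => n1x; exists x.
by move=> n1x; exists x; rewrite s1 //= (factors_exists F) ?s1.
Qed.

Lemma mat_induced K n1 n2 : V1 \subset vset K -> factors (mat K) V1 V2 n1 n2 ->
  mat (rb (induced K V1 V2)) = contract (mat K) V1 n1.
Proof.
move=> sV F; have [_ s1 _ _] := F.
have E x : (x \in V1) && [exists y in V2, adj K x y] = n1 x.
  case xV: (x \in V1); first by rewrite (factors_exists F).
  by apply/esym/negP => /s1; rewrite xV.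
apply/funext=> a; apply/funext=> b; rewrite /mat /contract.
case: a b => [x|] [y|] //=; last by rewrite is_whiteE /= !inE.
rewrite (inj_eq (@Some_inj _)); case: eqP => // <-.
rewrite !is_whiteE /= !inE /= !(mem_imset _ _ (@Some_inj _)) !inE.
by case xV: (x \in V1) => //=; rewrite (subsetP sV _ xV) /= andbT.
Qed.

End Fixed.

Lemma Some_eqE x y : (Some x == Some y) = (x == y).
Proof. by apply: inj_eq => ? ? []. Qed.

(** The Schur term on the V1 x V2 block is a multiple of [n2], so only [n1] changes. If u sees V2,
    the V2 block gains the product of [n2] with itself, as from a pivot at a whitened root; on the
    V1 side the pivot whitens the root, which the toggle undoes. *)
Lemma contract_pivot1 M (V1 V2 : {set T}) n1 n2 u : symmetric M ->
  [disjoint V1 & V2] -> factors M V1 V2 n1 n2 -> u \in V1 -> M u u ->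
  exists m1,
  [/\ factors (pivot1 M u) V1 V2 m1 n2,
      contract (pivot1 M u) V1 m1 =
        if n1 u then toggle (pivot1 (contract M V1 n1) (Some u)) None
        else pivot1 (contract M V1 n1) (Some u) &
      contract (pivot1 M u) V2 n2 =
        if n1 u then
          toggle (pivot1 (toggle (contract M V2 n2) None) None) None
        else contract M V2 n2].
Proof.
move=> Ms d F uV Mu; have [h s1 s2 e] := F.
(* The first factor of the pivoted block; the guard discards neighbours of u in V2. *)
pose m1 x := (x \in V1) && (n1 x (+) [&& x != u, M x u & n1 u]); exists m1.
have n1V x : n1 x = (x \in V1) && n1 x.
  by case: (boolP (n1 x)) => [/s1 ->|]; rewrite ?andbF.
have n2V x : n2 x = (x \in V2) && n2 x.
  by case: (boolP (n2 x)) => [/s2 ->|]; rewrite ?andbF.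
split.
- split=> [x y xV yV|x /andP[]|//|] //.
    rewrite /pivot1 /m1 xV (disjoint_neq d uV yV) (h x y) // (h u y) //=.
    by case: (x == u); case: (M x u); case: (n1 x); case: (n1 u); case: (n2 y).
  case nu: (n1 u); last first.
    rewrite -e; apply: eq_existsb => x; rewrite /m1 nu !andbF addbF.
    by rewrite -n1V.
  rewrite -e; apply/existsP/existsP => _; exists u => //.
  by rewrite /m1 uV eqxx nu.
- apply/funext=> a; apply/funext=> b; rewrite /toggle /pivot1 /m1.
  case nu: (n1 u); case: a b => [x|] [y|];
    rewrite /= ?Some_eqE ?uV ?nu ?andbT ?andbF ?addbF //=.
  + by case: (x \in V1); case: (y \in V1); rewrite /= ?andbF.
  + by rewrite (n1V x); case: (x \in V1); rewrite //= andbF.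
  + by rewrite (Ms y u) (n1V y); case: (y \in V1); rewrite //= andbF.
  + by case: (x \in V1); case: (y \in V1); rewrite /= ?andbF.
- apply/funext=> a; apply/funext=> b; rewrite /toggle /pivot1.
  case nu: (n1 u); case: a b => [x|] [y|];
    rewrite /= ?Some_eqE ?nu ?andbT ?andbF ?addbF //=.
  + case xV : (x \in V2); last by rewrite (n2V x) xV.
    case yV : (y \in V2); last by rewrite (n2V y) yV /= !andbF.
    rewrite (Ms x u) (h u x) // (h u y) // nu eq_sym (disjoint_neq d uV xV).
    by rewrite eq_sym (disjoint_neq d uV yV).
  + case xV : (x \in V2) => //=; case yV : (y \in V2) => //=.
    by rewrite (h u y) // nu !andbF addbF.
Qed.

Lemma exch_in (V : {set T}) u v x : u \in V -> v \in V ->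
  (exch u v x \in V) = (x \in V).
Proof.
rewrite /exch => uV vV; have [->|_] := eqVneq x u; first by rewrite uV vV.
by have [->|_] := eqVneq x v; rewrite ?uV ?vV.
Qed.

Lemma exch_Some u v x : exch (Some u) (Some v) (Some x) = Some (exch u v x).
Proof. by rewrite /exch !Some_eqE; case: (x == u); case: (x == v). Qed.

(** On the V2 block and at the root the two Schur terms are equal and cancel, so the other side is
    untouched and the root stays black. *)
Lemma contract_pivot2 M (V1 V2 : {set T}) n1 n2 u v : symmetric M ->
  [disjoint V1 & V2] -> factors M V1 V2 n1 n2 -> u \in V1 -> v \in V1 ->
  exists m1,
  [/\ factors (pivot2 M u v) V1 V2 m1 n2,
      contract (pivot2 M u v) V1 m1 =
        pivot2 (contract M V1 n1) (Some u) (Some v) &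
      contract (pivot2 M u v) V2 n2 = contract M V2 n2].
Proof.
move=> Ms d F uV vV; have [h s1 s2 e] := F.
pose m1 x := (x \in V1) && (n1 (exch u v x) (+)
  [&& x != u, x != v & (M x u && n1 v) (+) (M x v && n1 u)]).
have n1V x : n1 x = (x \in V1) && n1 x.
  by case: (boolP (n1 x)) => [/s1 ->|]; rewrite ?andbF.
have n2V x : n2 x = (x \in V2) && n2 x.
  by case: (boolP (n2 x)) => [/s2 ->|]; rewrite ?andbF.
have eyV y : y \in V2 -> exch u v y = y.
  by move=> yV; rewrite /exch !(disjoint_neq d _ yV).
have m1E : ~~ n1 u -> ~~ n1 v -> m1 =1 n1.
  move=> /negbTE nu /negbTE nv x; rewrite /m1 nu nv !andbF addbF /exch.
  have [->|_] := eqVneq x u; first by rewrite nu nv andbF.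
  have [->|_] := eqVneq x v; first by rewrite nu nv andbF.
  by rewrite -n1V.
exists m1; split.
- split=> [x y xV yV|x /andP[]|//|] //.
    rewrite /pivot2 /m1 xV (eyV y) // (h _ y) ?exch_in // (h u y) // (h v y) //.
    rewrite !(disjoint_neq d _ yV) //=.
    by case: (n2 y); rewrite ?andbF ?andbT //= ?andbF ?addbF.
  (* The pivot exchanges u and v, so a nonzero value of [n1] at one of them becomes a nonzero value
     of [m1] at the other. *)
  rewrite -e; case nu: (n1 u); last first.
    case nv: (n1 v); last by apply: eq_existsb; apply: m1E; rewrite ?nu ?nv.
    apply/existsP/existsP => _; [by exists v|exists u].
    by rewrite /m1 uV /exch !eqxx nv.
  apply/existsP/existsP => _; [by exists u|exists v].
  rewrite /m1 vV /exch eqxx andbF /= addbF.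
  by have [->|_] := eqVneq v u; rewrite nu.
- apply/funext=> a; apply/funext=> b; rewrite /pivot2 /m1.
  case: a b => [x|] [y|];
    rewrite ?exch_Some /= ?Some_eqE ?uV ?vV //= ?exch_in //.
  + by case: (x \in V1); case: (y \in V1); rewrite /= ?andbF ?addbF.
  + rewrite (n1V (exch _ _ _)) exch_in //.
    by case: (x \in V1); rewrite /= ?andbF.
  + rewrite (n1V (exch _ _ _)) exch_in // (Ms y u) (Ms y v).
    case: (y \in V1); rewrite /= ?andbF //.
    by case: (n1 u); case: (n1 v); case: (M u y); case: (M v y).
  + by rewrite andbC addbb.
- apply/funext=> a; apply/funext=> b; rewrite /pivot2.
  case: a b => [x|] [y|] //=.
  case xV : (x \in V2) => //=; case yV : (y \in V2) => //=.
  rewrite !eyV // (Ms x u) (Ms x v) (h u x) // (h v x) // (h u y) // (h v y) //.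
  by case: (M x y); case: (n1 u); case: (n1 v);
    case: (n2 x); case: (n2 y); rewrite /= ?andbF.
Qed.

(** Since [n2 v] holds, v is adjacent to exactly the vertices of V1 that the root is adjacent to, so
    on this side the root stands in for v. Afterwards the root sees u and the former neighbours of u
    in V1. *)
Lemma contract_pivot2_cross M (V1 V2 : {set T}) n1 n2 u v : symmetric M ->
  [disjoint V1 & V2] -> factors M V1 V2 n1 n2 -> u \in V1 -> v \in V2 ->
  M u v -> ~~ M u u -> ~~ M v v ->
  let m1 := fun x => (x \in V1) && ((x == u) || M x u) in
  contract (pivot2 M u v) V1 m1 = pivot2 (contract M V1 n1) (Some u) None.
Proof.
move=> Ms d F uV vV Muv /negbTE Mu /negbTE Mv m1; have [h s1 s2 e] := F.
have [nu nv] : n1 u /\ n2 v by apply/andP; rewrite -h.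
have n1V x : n1 x = (x \in V1) && n1 x.
  by case: (boolP (n1 x)) => [/s1 ->|]; rewrite ?andbF.
have Mn x : x \in V1 -> M x v = n1 x by move=> xV; rewrite h // nv andbT.
apply/funext=> a; apply/funext=> b; rewrite /pivot2 /m1.
case: a b => [x|] [y|]; rewrite /exch ?Some_eqE /= ?eqxx.
- have [->|xu] := eqVneq x u; have [->|yu] := eqVneq y u;
  rewrite ?uV ?(disjoint_neq d uV vV) ?(negbTE xu) ?(negbTE yu)
    ?eqxx //= ?Mv ?Mu ?addbF //.
  + case yV : (y \in V1) => /=; last by rewrite n1V yV.
    by rewrite (disjoint_neq d yV vV) (Ms v) Mn.
  + case xV : (x \in V1) => /=; last by rewrite n1V xV.
    by rewrite (disjoint_neq d xV vV) andbF addbF Mn.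
  + case xV : (x \in V1) => /=; last by rewrite (n1V x) xV.
    case yV : (y \in V1) => /=; last by rewrite (n1V y) yV /= !andbF.
    by rewrite !(disjoint_neq d _ vV) //= (Ms v) !Mn.
- have [->|xu] := eqVneq x u; first by rewrite uV /= nu.
  by rewrite /= uV /= addbF.
- have [->|yu] := eqVneq y u; first by rewrite uV /= nu.
  by rewrite /= uV (Ms y) addbF.
- by rewrite Mu !andbF.
Qed.

Lemma pivot2C M u v : u != v -> symmetric M -> pivot2 M u v = pivot2 M v u.
Proof.
move=> uv Ms; apply/funext=> x; apply/funext=> y; rewrite /pivot2.
have E t : exch u v t = exch v u t.
  rewrite /exch; have [->|_ //] := eqVneq t u; by rewrite (negbTE uv).
rewrite !E addbC [RHS]addbC; congr (_ (+) _).
rewrite [X in [&& _, _, _, _ & X]]addbC.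
by case: (x != u); case: (x != v); case: (y != u); case: (y != v).
Qed.

(** Away from u and v, the Schur term [M x v && M u y] equals the old product [n1 x && n2 y] and
    cancels it; the other term is the new product. *)
Lemma factors_cross M (V1 V2 : {set T}) n1 n2 u v : symmetric M ->
  [disjoint V1 & V2] -> factors M V1 V2 n1 n2 -> u \in V1 -> v \in V2 ->
  M u v -> ~~ M u u -> ~~ M v v ->
  factors (pivot2 M u v) V1 V2 (fun x => (x \in V1) && ((x == u) || M x u))
    (fun y => (y \in V2) && ((y == v) || M y v)).
Proof.
move=> Ms d F uV vV Muv /negbTE Mu /negbTE Mv; have [h s1 s2 e] := F.
have [nu nv] : n1 u /\ n2 v by apply/andP; rewrite -h.
split=> [x y xV yV|x /andP[]|y /andP[]|] //; last first.
  by apply/existsP/existsP => _; [exists v|exists u]; rewrite ?uV ?vV eqxx.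
have uv := disjoint_neq d uV vV.
rewrite /pivot2 /exch xV yV (disjoint_neq d xV vV) (disjoint_neq d uV yV) /=.
have [->|xu] := eqVneq x u; have [->|yv] := eqVneq y v; rewrite //= ?addbF.
- by rewrite (Ms v) Muv.
- by rewrite Ms.
- by rewrite andbT.
- rewrite (h x y) // (h x v) // (h u y) // nu nv andbT /= (Ms v y).
  by case: (n1 x); case: (n2 y); case: (M x u); case: (M y v).
Qed.

(** The invariant of one generator step; its symmetry in V1 and V2 halves the case analysis. *)
Definition linked G H (V1 V2 : {set T}) := exists f f',
  is_split H V1 V2 /\ [/\ glued f f', crosses H V1 V2 = crosses G V1 V2,
      ~~ crosses G V1 V2 -> f = id /\ f' = id,
      root_link f (induced G V1 V2) (induced H V1 V2) &
      root_link f' (induced G V2 V1) (induced H V2 V1)].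

Lemma linked_sym G H (V1 V2 : {set T}) : linked G H V1 V2 -> linked G H V2 V1.
Proof.
case=> f [f' [sp [gl ec nc L L']]]; exists f', f.
split; first exact: is_split_sym.
split=> //.
- exact: glued_sym.
- by rewrite !(crosses_sym _ V2).
- by rewrite crosses_sym => /nc [].
Qed.

Lemma linked_factors G H (V1 V2 : {set T}) n1 n2 m1 m2 f f' :
  is_split G V1 V2 -> vset H = vset G ->
  factors (mat G) V1 V2 n1 n2 -> factors (mat H) V1 V2 m1 m2 -> glued f f' ->
  [exists x, m1 x] = [exists x, n1 x] ->
  (~~ [exists x, n1 x] -> f = id /\ f' = id) ->
  rlag_map None f (contract (mat G) V1 n1) (contract (mat H) V1 m1) ->
  rlag_map None f' (contract (mat G) V2 n2) (contract (mat H) V2 m2) ->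
  linked G H V1 V2.
Proof.
move=> [eV d c1 c2 _] eVH FG FH gl ec nc h1 h2; exists f, f'.
have d' : [disjoint V2 & V1] by rewrite disjoint_sym.
have GH (K : bigraph T) : vset K = vset G ->
    V1 \subset vset K /\ V2 \subset vset K.
  by move=> ->; rewrite -eV subsetUl subsetUr.
have [G1 G2] := GH G erefl; have [H1 H2] := GH H eVH.
have sym (K : bigraph T) := mat_sym K.
split; first by apply: (factors_split d (n1 := m1) (n2 := m2)); rewrite ?eVH.
split=> //.
- by rewrite (crosses_factors d FG) (crosses_factors d FH).
- by rewrite (crosses_factors d FG).
- by split=> //; rewrite (mat_induced d G1 FG) (mat_induced d H1 FH).
- split=> //; rewrite (mat_induced d' G2 (factors_sym (sym G) FG)).
  by rewrite (mat_induced d' H2 (factors_sym (sym H) FH)).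
Qed.

(** If u sees V2, the root undergoes [shear2] on the side of u and [shear1] on the other side;
    otherwise both actions are trivial. *)
Lemma linked_white G (V1 V2 : {set T}) u : is_split G V1 V2 -> is_white G u ->
  u \in V1 -> linked G (lcomp G u) V1 V2.
Proof.
move=> sp uw uV; have [_ d _ _ _] := sp; have [n1 [n2 F]] := split_factors d sp.
have Mu : mat G u u by rewrite /mat eqxx.
have [m1 [F' e1 e2]] := contract_pivot1 (mat_sym G) d F uV Mu.
rewrite -!mat_lcomp_white // in F' e1 e2; move: e1 e2.
have Cu : contract (mat G) V1 n1 (Some u) (Some u) by rewrite /= uV.
have h1 : rlag_map None id (contract (mat G) V1 n1)
    (pivot1 (contract (mat G) V1 n1) (Some u)).
  by have := swap_on_rlag_map None (lag_pivot1 Cu); rewrite /swap_on inE.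
have ec M m : factors M V1 V2 m n2 -> [exists x, m x] = [exists x, n1 x].
  by case=> _ _ _ ->; have [_ _ _ ->] := F.
case: ifP => nu e1 e2.
  apply: (linked_factors sp _ F F' Glued_21) => //.
  - exact: ec F'.
  - by case/existsP; exists u.
  - by rewrite e1; exact: rlag_map_trans h1 (rlag_map_toggle _ _).
  - rewrite e2; set N := contract _ V2 n2.
    have Cz : toggle N None None None by [].
    have h2 := swap_on_rlag_map None (lag_pivot1 Cz).
    apply: eq_rlag_map
      (rlag_map_trans (rlag_map_trans (rlag_map_toggle None N) h2)
      (rlag_map_toggle _ _)).
    (* Whitening, pivoting and blackening the root compose to [shear1]. *)
    by rewrite /swap_on inE eqxx => [[[] []]].
apply: (linked_factors sp _ F F' Glued_id) => //.
- exact: ec F'.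
- by rewrite e1.
- by rewrite e2; exact: rlag_map_refl.
Qed.
Lemma mat_black G u : is_black G u -> ~~ mat G u u.
Proof. by rewrite /mat eqxx is_whiteE /is_black => ->; rewrite andbF. Qed.

Lemma linked_black_same G (V1 V2 : {set T}) u v : is_split G V1 V2 ->
  is_black G u -> is_black G v -> adj G u v -> u \in V1 -> v \in V1 ->
  linked G (word_act G [:: u; v; u]) V1 V2.
Proof.
move=> sp ub vb uv uV vV; have [_ d _ _ _] := sp.
have [n1 [n2 F]] := split_factors d sp.
have [m1 [F' e1 e2]] := contract_pivot2 (mat_sym G) d F uV vV.
rewrite -!mat_pivot2 // in F' e1 e2.
have nuv := adj_neq uv; have Guv : mat G u v by rewrite mat_adj.
have sN : Some u != Some v by rewrite Some_eqE.
have h1 := lag_pivot2 (M := contract (mat G) V1 n1) sN.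
rewrite /= uV vV Guv (mat_sym G v) Guv in h1.
have {h1} := swap_on_rlag_map None (h1 isT isT (mat_black ub) (mat_black vb)).
rewrite -e1 /swap_on !inE => h1.
apply: (linked_factors sp _ F F' Glued_id) => //.
- by have [_ _ _ ->] := F'; have [_ _ _ ->] := F.
- by rewrite e2; exact: rlag_map_refl.
Qed.

(** Each side sees a pivot on an edge ending at its root, hence [swap] at both roots. *)
Lemma linked_black_cross G (V1 V2 : {set T}) u v : is_split G V1 V2 ->
  is_black G u -> is_black G v -> adj G u v -> u \in V1 -> v \in V2 ->
  linked G (word_act G [:: u; v; u]) V1 V2.
Proof.
move=> sp ub vb uv uV vV; have [_ d _ _ _] := sp.
have [n1 [n2 F]] := split_factors d sp.
have Ms := mat_sym G; have nuv := adj_neq uv.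
have Guv : mat G u v by rewrite mat_adj.
have Gvu : mat G v u by rewrite Ms.
have [Mu Mv] := (mat_black ub, mat_black vb).
have F' := factors_cross Ms d F uV vV Guv Mu Mv.
have d' : [disjoint V2 & V1] by rewrite disjoint_sym.
have e1 := contract_pivot2_cross Ms d F uV vV Guv Mu Mv.
have e2 := contract_pivot2_cross Ms d' (factors_sym Ms F) vV uV Gvu Mv Mu.
rewrite (pivot2C _ Ms) 1?eq_sym // in e2.
rewrite -!mat_pivot2 // in F' e1 e2.
have [nu nv] : n1 u /\ n2 v by have [h _ _ _] := F; apply/andP; rewrite -h.
have c V n w : n w -> ~~ mat G w w ->
    rlag_map None swap (contract (mat G) V n)
      (pivot2 (contract (mat G) V n) (Some w) None).
  move=> nw Mw; have := lag_pivot2 (M := contract (mat G) V n)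
    (u := Some w) (v := None) isT nw nw => h.
  have /= := swap_on_rlag_map None (h _ isT).
  by rewrite (negbTE Mw) !andbF /swap_on !inE /=; apply.
apply: (linked_factors sp _ F F' Glued_swap) => //.
- have -> : [exists x, n1 x] by apply/existsP; exists u.
  by apply/existsP; exists u; rewrite uV eqxx.
- by case/existsP; exists u.
- by rewrite e1; exact: c.
- by rewrite e2; exact: c.
Qed.

Lemma linked_black G (V1 V2 : {set T}) u v : is_split G V1 V2 ->
  is_black G u -> is_black G v -> adj G u v ->
  linked G (word_act G [:: u; v; u]) V1 V2.
Proof.
move=> sp ub vb uv; have sp' := is_split_sym sp; have [eV _ _ _ _] := sp.
have vu : adj G v u by rewrite (adj_sym G).
have := adj_vset uv; have := adj_vset vu; rewrite -eV !inE.
case/orP=> vV /orP[] uV.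
- exact: linked_black_same.
- exact/linked_sym/linked_black_cross.
- exact: linked_black_cross.
- exact/linked_sym/linked_black_same.
Qed.

Lemma linked_pairs G H (V1 V2 : {set T}) : linked G H V1 V2 ->
  [/\ is_split H V1 V2,
      Permutation (class_pairs H V1 V2) (class_pairs G V1 V2) &
      Permutation (class_pairs H V2 V1) (class_pairs G V2 V1)].
Proof.
move=> GH; have [f [f' [sp [gl ec nc L L']]]] := GH.
have [g [g' [_ [gl' ec' nc' M M']]]] := linked_sym GH.
split=> //; first exact: class_pairs_perm gl ec nc L L'.
exact: class_pairs_perm gl' ec' nc' M M'.
Qed.

End Split.

Theorem theorem2p5p12 (T : finType) (G : bigraph T) (V1 V2 : {set T}) :
  is_split G V1 V2 ->
  forall H : bigraph T, parity_class G H ->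
    [/\ is_split H V1 V2,
        Permutation (class_pairs H V1 V2) (class_pairs G V1 V2) &
        Permutation (class_pairs H V2 V1) (class_pairs G V2 V1)].
Proof.
move=> sp H [s Ws ->].
have catE t t' : word_act G (t ++ t') = word_act (word_act G t) t'.
  exact: foldl_cat.
(* The reference graph [K0], later G, stays fixed while permutations accumulate along the word; the
   split of the current graph is carried along because each generator step starts from it. *)
suff step K L : linked K L V1 V2 -> forall K0 : bigraph T,
    [/\ is_split K V1 V2,
        Permutation (class_pairs K V1 V2) (class_pairs K0 V1 V2) &
        Permutation (class_pairs K V2 V1) (class_pairs K0 V2 V1)] ->
    [/\ is_split L V1 V2,
        Permutation (class_pairs L V1 V2) (class_pairs K0 V1 V2) &
        Permutation (class_pairs L V2 V1) (class_pairs K0 V2 V1)].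
  elim: Ws => {s} [|s u _ IH uw|s u v _ IH ub vb uv|s u v _ IH ub vb uv];
    rewrite ?catE.
  - by split.
  - have [spK _ _] := IH; apply: step IH; have [eV _ _ _ _] := spK.
    have : u \in vset (word_act G s) by move: uw; rewrite is_whiteE => /andP[].
    rewrite -eV inE => /orP[] uV; first exact: linked_white.
    by apply/linked_sym/linked_white => //; exact: is_split_sym.
  - by have [spK _ _] := IH; apply: step IH; exact: linked_black.
  - have [spK _ _] := IH; apply: step IH; apply: linked_black => //.
    by rewrite (adj_sym (word_act G s)).
move=> /linked_pairs[spL p q] K0 [_ p0 q0].
by split=> //; [exact: Permutation_trans p p0|exact: Permutation_trans q q0].
Qed.
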